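(* Let $\theta$ be an absolute norm on $\mathbf{R}^K$ which is $(\overline{\varkappa},\overline{\varsigma})$-regular, and let $\|\cdot\|_i$ be $(\varkappa',\varsigma')$-regular norms on $\mathbf{R}^{n_i}$, $1\le i\le K$. Then the norm $$\|[x_1;\ldots;x_K]\|=\theta^{1/2}\big(\|x_1\|_1^2,\ldots,\|x_K\|_K^2\big),\qquad x_i\in\mathbf{R}^{n_i},$$ is $(\varkappa,\varsigma)$-regular on $\mathbf{R}^{n_1+\cdots+n_K}$, with $\varkappa=2\overline{\varkappa}+\varkappa'$ and $\varsigma=\varsigma'\sqrt{\overline{\varsigma}}$.
   Context: For reals $\varkappa\ge 1$, a norm $\mathfrak{n}(\cdot)$ on $\mathbf{R}^n$ is called $\varkappa$-smooth if the function $\Phi(x)=\mathfrak{n}^2(x)$ is continuously differentiable and $\Phi(x+h)\le\Phi(x)+[\Phi'(x)]^Th+\varkappa\Phi(h)$ for all $x,h\in\mathbf{R}^n$. For reals $\varkappa\ge1,\varsigma\ge1$, a norm $\|\cdot\|$ on $\mathbf{R}^n$ is called $(\varkappa,\varsigma)$-regular if there exists a $\varkappa$-smooth norm $\mathfrak{n}(\cdot)$ on $\mathbf{R}^n$ such that $\varsigma^{-1}\mathfrak{n}(x)\le\|x\|\le\varsigma\,\mathfrak{n}(x)$ for all $x$. All regularity parameters ($\overline{\varkappa},\overline{\varsigma},\varkappa',\varsigma'$) are reals $\ge1$. A norm $\theta$ on $\mathbf{R}^K$ is absolute if $\theta(t)$ depends only on the absolute values of the entries of $t$, i.e. $\theta([t_1;\ldots;t_K])=\theta([|t_1|;\ldots;|t_K|])$.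 The notation $[x_1;\ldots;x_K]$ denotes vertical concatenation of vectors. Each $\|\cdot\|_i$ here is an arbitrary given norm (the index $i$ does not denote an $\ell_i$-norm). *)

(* Defs.v *)
From HB Require Import structures.
From mathcomp Require Import all_boot all_order all_algebra.
From mathcomp Require Import all_classical all_reals all_analysis.

Set Implicit Arguments.
Unset Strict Implicit.
Unset Printing Implicit Defensive.

Import Order.TTheory GRing.Theory Num.Theory.
Import numFieldNormedType.Exports.

Local Open Scope classical_set_scope.
Local Open Scope ring_scope.

(* Several norms live on the same space, so a norm is a predicate on functions
   rather than the normed structure attached to the type.  The topology on
   'cV[R]_n is the library's (sup-norm) one, i.e. the usual topology of R^n. *)
Record is_norm (R : realType) (n : nat) (p : 'cV[R]_n -> R) : Prop := IsNorm {
  is_norm_ge0 : forall x, 0 <= p x;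
  is_norm_eq0 : forall x, p x = 0 -> x = 0;
  is_normZ : forall (a : R) x, p (a *: x) = `|a| * p x;
  is_norm_triangle : forall x y, p (x + y) <= p x + p y
}.

Definition absolute (R : realType) (n : nat) (p : 'cV[R]_n -> R) : Prop :=
  forall t, p t = p (\col_i `|t i 0|).

Definition gradient (R : realType) (n : nat) (f : 'cV[R]_n -> R)
    (x : 'cV[R]_n) : 'cV[R]_n :=
  \col_i 'D_(delta_mx i 0) f x.

Definition continuously_differentiable (R : realType) (n : nat)
    (f : 'cV[R]_n -> R) : Prop :=
  (forall x, differentiable f x) /\ continuous (gradient f).

Definition smooth_norm (R : realType) (n : nat) (kappa : R)
    (p : 'cV[R]_n -> R) : Prop :=
  let Phi x := p x ^+ 2 in
  [/\ 1 <= kappa, is_norm p, continuously_differentiable Phi &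
      forall x h,
        Phi (x + h) <= Phi x + ((gradient Phi x)^T *m h) 0 0 + kappa * Phi h].

Definition regular_norm (R : realType) (n : nat) (kappa sigma : R)
    (p : 'cV[R]_n -> R) : Prop :=
  [/\ 1 <= kappa, 1 <= sigma, is_norm p &
      exists q : 'cV[R]_n -> R, smooth_norm kappa q /\
        forall x, sigma^-1 * q x <= p x <= sigma * q x].

(* [submxcol x i] is the i-th block x_i of x = [x_1; ...; x_K]. *)
Definition block_norm (R : realType) (K : nat) (n : 'I_K -> nat)
    (theta : 'cV[R]_K -> R) (nrm : forall i, 'cV[R]_(n i) -> R)
    (x : 'cV[R]_(\sum_(i < K) n i)) : R :=
  Num.sqrt (theta (\col_i nrm i (submxcol x i) ^+ 2)).

(* Main.v *)
Require Import Defs.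
From HB Require Import structures.
From mathcomp Require Import all_boot all_order all_algebra.
From mathcomp Require Import all_classical all_reals all_analysis.
From mathcomp Require Import ring lra.

Set Implicit Arguments.
Unset Strict Implicit.
Unset Printing Implicit Defensive.

Import Order.TTheory GRing.Theory Num.Theory.
Import numFieldNormedType.Exports.

Local Open Scope ring_scope.

(** The square Phi of a norm is convex and 2-homogeneous, and for such a
    function the one-sided bound
      Phi (x + h) <= Phi x + g h + kappa * Phi h   (some linear form g at each x)
    already carries all the regularity: applying it at h and - h and using
    convexity gives the matching lower bound, so that Phi is differentiable with
    derivative g, and comparing the bounds at x and at x + d shows that g is
    Lipschitz ([smooth_norm_of_quad_upper]).  Smoothness thus becomes a purely
    algebraic property, [quad_upper], which is then followed through averages and
    compositions.

    The smooth norm q close to theta need not be absolute.  The root mean square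
    of q over all sign changes of the coordinates is absolute, has the same
    constant kappabar because the bound passes to averages, and is still
    sigmabar-close to theta because theta itself ignores signs ([sign_mean]).
    Let vartheta be this mean, and p_i the smooth norm close to the i-th norm.

    Put P(x) = (p_i(x_i)^2)_i, y = P(x) and Phi(x) = vartheta(P(x)).  An absolute
    norm is monotone in the absolute values of the coordinates ([absolute_le]),
    so the bounds P(x + h) <= y + u + kappa' P(h) on the blocks, where u_i is the
    linear term g_i h_i, give
      Phi(x + h) <= vartheta(y + u) + kappa' Phi(h).
    Since a convex function has slopes controlled by its values,
    |u_i| <= 2 p_i(x_i) p_i(h_i) ([quad_slope_le]), whence
    vartheta(u)^2 <= 4 Phi(x) Phi(h) ([absolute_cauchy_schwarz]).  The bound for
    vartheta^2 at y and the inequality sqrt(a^2 + b) <= a + b / (2 a) then yield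
      vartheta(y + u) <= Phi(x) + (linear in h) + 2 kappabar Phi(h),
    which is the announced constant ([block_quad_upper]).  The linear term is
    kept inside vartheta and only the increment u, not P(x + h) - P(x), is
    expanded, so that the bound holds for large h and not only to second order. *)

(** * Optimizing a scaling parameter *)

Lemma le_of_add_mul_pos (R : realType) (a b c : R) :
  0 <= c -> (forall t, 0 < t -> a <= b + t * c) -> a <= b.
Proof.
move=> c0 H; apply/ler_addgt0Pr => e e0.
have c1 : 0 < c + 1 by lra.
apply: le_trans (H (e / (c + 1)) _) _; first exact: divr_gt0.
rewrite lerD2l mulrAC ler_pdivrMr // ler_pM2l //; lra.
Qed.

(** The infimum over c of the right-hand side is [2 a b]; it is attained at
    [c = b / a] when both are positive, and only approached when exactly one of
    them vanishes. *)
Lemma le_2mul_of_forall_scaling (R : realType) (a b m : R) :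
  0 <= a -> 0 <= b ->
  (forall c, 0 < c -> m <= c * a ^+ 2 + c^-1 * b ^+ 2) -> m <= 2 * (a * b).
Proof.
move=> a0 b0 H.
have [//|mgt] := leP m (2 * (a * b)).
have m0 : 0 < m by apply: le_lt_trans mgt; rewrite !mulr_ge0.
(* When a or b vanishes, c is chosen so that the remaining term is below m. *)
have [a_eq0|a_neq0] := eqVneq a 0.
  have c0 : 0 < (b ^+ 2 + 1) / m by rewrite divr_gt0 // ltr_wpDl ?sqr_ge0.
  have := H _ c0; rewrite a_eq0 expr0n mulr0 add0r invf_div mulrAC.
  rewrite ler_pdivlMr ?ltr_wpDl ?sqr_ge0 // ler_pM2l //; lra.
have [b_eq0|b_neq0] := eqVneq b 0.
  have c0 : 0 < m / (a ^+ 2 + 1) by rewrite divr_gt0 // ltr_wpDl ?sqr_ge0.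
  have := H _ c0; rewrite b_eq0 expr0n mulr0 addr0 mulrAC.
  rewrite ler_pdivlMr ?ltr_wpDl ?sqr_ge0 // ler_pM2l //; lra.
have c0 : 0 < b / a by rewrite divr_gt0 // lt_def ?a_neq0 ?b_neq0.
have := H _ c0; have -> : b / a * a ^+ 2 + (b / a)^-1 * b ^+ 2 = 2 * (a * b).
  by field; rewrite a_neq0 b_neq0.
lra.
Qed.

(** Converse of [sq_norm_triangle] below: together they let the triangle
    inequality of a norm be checked on its square, where it is stable under sums
    and under monotone sublinear maps. *)
Lemma le_add_of_sq_triangle (R : realType) (a b m : R) : 0 <= a -> 0 <= b ->
  (forall c, 0 < c -> m ^+ 2 <= (1 + c) * a ^+ 2 + (1 + c^-1) * b ^+ 2) ->
  m <= a + b.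
Proof.
move=> a0 b0 H.
have : m ^+ 2 - a ^+ 2 - b ^+ 2 <= 2 * (a * b).
  apply: le_2mul_of_forall_scaling => // c c0; have := H c c0; lra.
have [m0|m0 ab] := leP m 0; first by move=> _; lra.
rewrite -ler_sqr ?nnegrE ?addr_ge0 ?(ltW m0) //; lra.
Qed.

(** * From a quadratic upper bound to a smooth norm *)

Lemma differentiable_of_quadratic_error (R : realType) (V W : normedModType R)
    (f : V -> W) (df : {linear V -> W}) (x : V) (M C : R) :
  (forall h, `|df h| <= M * `|h|) ->
  (forall h, `|f (x + h) - f x - df h| <= C * `|h| ^+ 2) ->
  differentiable f x /\ 'd f x = df :> (V -> W).
Proof.
move=> dfM fC.
have df_cont : continuous df.
  apply/linear_bounded_continuous/linear_boundedP; near=> r => h.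
  apply: le_trans (dfM h) _.
  by rewrite ler_wpM2r //; near: r; exact: nbhs_pinfty_ge.
have f_df : f \o shift x = cst (f x) + df +o_ 0 id.
  apply/eqaddoP => e e0 /=.
  have d0 : 0 < e / (`|C| + 1) by rewrite divr_gt0 // ltr_wpDl.
  near=> h.
  have hd : `|h| <= e / (`|C| + 1).
    near: h; apply/nbhs_norm0P; exists (e / (`|C| + 1)) => //= z /=; exact: ltW.
  rewrite !fctE /= opprD addrA [h + x]addrC.
  apply: le_trans (fC h) _; rewrite expr2 mulrA ler_wpM2r //.
  move: hd; rewrite ler_pdivlMr ?ltr_wpDl // mulrC; apply: le_trans.
  by rewrite ler_wpM2r // (le_trans (ler_norm C)) // lerDl.
have dE := diff_unique df_cont f_df.
by split => //; apply/diff_locallyP; rewrite dE.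
Unshelve. all: by end_near.
Qed.

Section Norm.
Variables (R : realType) (n : nat) (p : 'cV[R]_n -> R).
Hypothesis pN : is_norm p.

Lemma is_norm0 : p 0 = 0.
Proof. by rewrite -(scale0r 0) (is_normZ pN) normr0 mul0r. Qed.

Lemma is_normN x : p (- x) = p x.
Proof. by rewrite -scaleN1r (is_normZ pN) normrN1 mul1r. Qed.

Lemma is_norm_le_sup : exists2 C, 0 < C & forall x, p x <= C * `|x|.
Proof.
exists (1 + \sum_i p (delta_mx i 0)) => [|x].
  by rewrite ltr_pwDl // sumr_ge0 // => i _; exact: is_norm_ge0.
have xE : x = \sum_i x i 0 *: delta_mx i 0.
  by rewrite {1}[x]matrix_sum_delta; apply: eq_bigr => i _; rewrite big_ord1.
rewrite [in leLHS]xE.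
have : p (\sum_i x i 0 *: delta_mx i 0) <= \sum_i p (x i 0 *: delta_mx i 0).
  elim/big_ind2: _ => [|a b c d ab cd|//]; first by rewrite is_norm0.
  by apply: le_trans (is_norm_triangle pN _ _) _; exact: lerD.
move/le_trans; apply; rewrite mulrDl mul1r -[leLHS]add0r lerD //.
rewrite mulr_suml ler_sum // => i _.
rewrite (is_normZ pN) mulrC ler_wpM2l ?(is_norm_ge0 pN) //.
rewrite [leRHS]/Num.Def.normr /= mx_normrE.
by apply/bigmax_geP; right; exists (i, 0).
Qed.

Lemma sq_norm_triangle x y c : 0 < c ->
  p (x + y) ^+ 2 <= (1 + c) * p x ^+ 2 + (1 + c^-1) * p y ^+ 2.
Proof.
move=> c0; apply: (@le_trans _ _ ((p x + p y) ^+ 2)).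
  rewrite ler_sqr ?nnegrE ?addr_ge0 ?(is_norm_ge0 pN) //.
  exact: is_norm_triangle.
rewrite -subr_ge0.
have -> : (1 + c) * p x ^+ 2 + (1 + c^-1) * p y ^+ 2 - (p x + p y) ^+ 2 =
   c^-1 * (c * p x - p y) ^+ 2 by field; rewrite gt_eqF.
by rewrite mulr_ge0 ?sqr_ge0 // invr_ge0 ltW.
Qed.

(** The inequality in the definition of a [kappa]-smooth norm, with an
    unspecified row vector in place of the gradient. *)
Definition quad_upper (kappa : R) := forall x, exists g : 'rV[R]_n,
  forall h, p (x + h) ^+ 2 <= p x ^+ 2 + (g *m h) 0 0 + kappa * p h ^+ 2.

(** Midpoint convexity of the square, [2 p(x)^2 <= p(x + h)^2 + p(x - h)^2],
    turns the upper bound at [- h] into a lower bound at [h]. *)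
Lemma quad_lower kappa x (g : 'rV[R]_n) :
  (forall h, p (x + h) ^+ 2 <= p x ^+ 2 + (g *m h) 0 0 + kappa * p h ^+ 2) ->
  forall h,
  p x ^+ 2 + (g *m h) 0 0 - kappa * p h ^+ 2 <= p (x + h) ^+ 2.
Proof.
move=> gP h; have := gP (- h); rewrite mulmxN mxE is_normN.
have := @sq_norm_triangle (x + h) (x - h) 1 ltr01.
have -> : x + h + (x - h) = 2 *: x.
  by rewrite addrACA subrr addr0 scaler_nat mulr2n.
rewrite (is_normZ pN) ger0_norm // exprMn invr1; lra.
Qed.

(** Along [x + t h] the square grows at most like [(p x + t p h)^2], whose slope
    at [t = 0] is [2 p x p h]; the lower bound makes the slope [g h] comparable
    to it up to an error of order [t]. *)
Lemma quad_slope_le kappa x (g : 'rV[R]_n) : 1 <= kappa ->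
  (forall h, p (x + h) ^+ 2 <= p x ^+ 2 + (g *m h) 0 0 + kappa * p h ^+ 2) ->
  forall h, `|(g *m h) 0 0| <= 2 * (p x * p h).
Proof.
move=> k1 gP h.
wlog suff H : h / (g *m h) 0 0 <= 2 * (p x * p h).
  rewrite ler_norml H andbT.
  by have := H (- h); rewrite mulmxN mxE is_normN => ?; lra.
apply: (@le_of_add_mul_pos _ _ _ ((1 + kappa) * p h ^+ 2)) => [|t t0].
  by rewrite mulr_ge0 ?sqr_ge0 //; lra.
rewrite -(ler_pM2l t0).
have := quad_lower gP (t *: h); rewrite -scalemxAr mxE (is_normZ pN) (gtr0_norm t0).
have : p (x + t *: h) ^+ 2 <= (p x + t * p h) ^+ 2.
  rewrite ler_sqr ?nnegrE ?addr_ge0 ?mulr_ge0 ?(is_norm_ge0 pN) ?(ltW t0) //.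
  apply: le_trans (is_norm_triangle pN _ _) _.
  by rewrite (is_normZ pN) gtr0_norm.
nra.
Qed.

Lemma differentiable_quad kappa x (g : 'rV[R]_n) : 1 <= kappa ->
  (forall h, p (x + h) ^+ 2 <= p x ^+ 2 + (g *m h) 0 0 + kappa * p h ^+ 2) ->
  differentiable (fun x => p x ^+ 2) x /\
  forall h, 'D_h (fun x => p x ^+ 2) x = (g *m h) 0 0.
Proof.
move=> k1 gP; pose dF := fun h : 'cV[R]_n => (g *m h) 0 0 : R.
have dFlin : linear dF.
  by move=> a u v; rewrite /dF mulmxDr -scalemxAr !mxE.
pose HdF := GRing.isLinear.Build _ _ _ _ dF dFlin.
pose L : {linear 'cV[R]_n -> R} := HB.pack dF HdF.
have [C C0 pC] := is_norm_le_sup.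
have [||df dE] := @differentiable_of_quadratic_error R 'cV[R]_n R
  (fun x => p x ^+ 2) L x (2 * p x * C) (kappa * C ^+ 2).
- move=> h; apply: le_trans (quad_slope_le k1 gP h) _.
  by rewrite -!mulrA !ler_wpM2l ?(is_norm_ge0 pN).
- move=> h; apply: (@le_trans _ _ (kappa * p h ^+ 2)).
    have up := gP h; have lo := quad_lower gP h.
    rewrite ler_norml /= /dF; apply/andP; split; lra.
  rewrite -mulrA -exprMn ler_wpM2l ?ler_sqr ?nnegrE ?mulr_ge0 //; first lra.
    exact: is_norm_ge0.
  exact: ltW.
by split => // h; rewrite deriveE // dE.
Qed.

(** Continuity of the gradient comes from the bounds alone: the upper bound at
    [x] for the increment [d + h] and the lower bounds at [x] for [d] and at
    [x + d] for [h] combine to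
    [(g (x + d) - g x) h <= kappa (p(d + h)^2 + p(d)^2 + p(h)^2)], which is of
    order [r^2] when [d] and [h] have size [r]. *)
Lemma smooth_norm_of_quad_upper kappa : 1 <= kappa ->
  quad_upper kappa -> smooth_norm kappa p.
Proof.
move=> k1 /choice[g gP].
have diffE x := differentiable_quad k1 (gP x).
have gradE x : gradient (fun x => p x ^+ 2) x = (g x)^T.
  by apply/colP => i; rewrite !mxE (diffE x).2 -colE !mxE.
split => //; last by move=> x h; rewrite gradE trmxK.
split=> [x|x]; first exact: (diffE x).1.
have [C C0 pC] := is_norm_le_sup.
have grad_near (d : 'cV[R]_n) r : 0 < r -> `|d| <= r ->
    `|gradient (fun x => p x ^+ 2) (x + d) - gradient (fun x => p x ^+ 2) x|
      <= 6 * kappa * C ^+ 2 * r.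
  move=> r0 dr.
  (* The constant 6 is 4 + 1 + 1, since the increment d + h has size at most 2 r. *)
  have slope (h : 'cV[R]_n) : `|h| <= r ->
      ((g (x + d) - g x) *m h) 0 0 <= 6 * kappa * C ^+ 2 * r ^+ 2.
    move=> hr.
    have up := gP x (d + h).
    have lo_d := quad_lower (gP x) d.
    have lo_h := quad_lower (gP (x + d)) h.
    have pr (z : 'cV[R]_n) s :
        `|z| <= s -> kappa * p z ^+ 2 <= kappa * (C ^+ 2 * s ^+ 2).
      move=> zs; rewrite ler_wpM2l; [by []|lra|].
      rewrite -exprMn ler_sqr ?nnegrE ?(is_norm_ge0 pN) ?mulr_ge0 ?(ltW C0) //.
        by apply: le_trans (pC z) _; rewrite ler_pM2l.
      exact: le_trans zs.
    have pd := pr d r dr; have ph := pr h r hr.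
    have pdh : kappa * p (d + h) ^+ 2 <= kappa * (C ^+ 2 * (r + r) ^+ 2).
      by apply: pr; apply: le_trans (ler_normD _ _) _; exact: lerD.
    have gD : (g x *m (d + h)) 0 0 = (g x *m d) 0 0 + (g x *m h) 0 0.
      by rewrite mulmxDr mxE.
    have gB : ((g (x + d) - g x) *m h) 0 0 =
        (g (x + d) *m h) 0 0 - (g x *m h) 0 0.
      by rewrite mulmxBl !mxE.
    by move: up; rewrite addrA gD gB; lra.
  have M0 : 0 <= 6 * kappa * C ^+ 2 * r.
    by rewrite !mulr_ge0 ?(ltW C0) ?(ltW r0) //; lra.
  (* Testing the slope on h = r e_i and on h = - r e_i bounds the coordinate i. *)
  rewrite [leLHS]/Num.Def.normr /= mx_normrE; apply: bigmax_le => // -[i j] _ /=.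
  rewrite ord1 !gradE {j}.
  have unit_le s : `|s| <= 1 -> `|(s * r) *: delta_mx i 0 : 'cV[R]_n| <= r.
    move=> s1; rewrite [leLHS]/Num.Def.normr /= mx_normrE.
    apply: bigmax_le => [|[k l] _ /=]; first exact: ltW.
    rewrite !mxE !normrM (gtr0_norm r0) mulrAC ler_piMl ?(ltW r0) //.
    by rewrite mulr_ile1 // normr_nat; case: (_ && _).
  have coord s : `|s| <= 1 -> s * (g (x + d) - g x) 0 i <= 6 * kappa * C ^+ 2 * r.
    move=> /unit_le/slope; rewrite -scalemxAr -colE !mxE => H.
    by rewrite -(ler_pM2r r0) [leLHS]mulrAC -[leRHS]mulrA -expr2.
  have := coord 1; have := coord (-1); rewrite normrN normr1 lexx !mxE.
  move=> /(_ isT) lo /(_ isT) up; rewrite ler_norml; apply/andP; split; lra.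
have L0 : 0 < 6 * kappa * C ^+ 2.
  by rewrite !mulr_gt0 ?exprn_gt0 //; lra.
apply/(@cvgrPdist_le _ _ _ (nbhs x)) => e e0; near=> y.
rewrite distrC -[y](subrKC x).
apply: le_trans (@grad_near (y - x) (e / (6 * kappa * C ^+ 2)) _ _) _.
- by rewrite divr_gt0.
- rewrite distrC; near: y; apply: cvgr_dist_le => //; exact: divr_gt0.
- by rewrite mulrC divfK ?gt_eqF.
Unshelve. all: by end_near.
Qed.
End Norm.

Lemma quad_upper_of_smooth_norm (R : realType) (n : nat) (kappa : R)
    (p : 'cV[R]_n -> R) : smooth_norm kappa p -> quad_upper p kappa.
Proof.
by case=> _ _ _ pP x; exists (gradient (fun x => p x ^+ 2) x)^T; exact: pP.
Qed.

(** * Absolute norms *)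

Section Absolute.
Variables (R : realType) (K : nat) (theta : 'cV[R]_K -> R).
Hypothesis thetaN : is_norm theta.
Hypothesis theta_abs : absolute theta.

Lemma absolute_eq (s t : 'cV[R]_K) :
  (forall i, `|s i 0| = `|t i 0|) -> theta s = theta t.
Proof.
move=> st; rewrite (theta_abs s) (theta_abs t); congr theta.
by apply/colP => i; rewrite !mxE st.
Qed.

(** Shrinking one coordinate of [t] gives a convex combination of [t] and of its
    reflection in that coordinate, and both have the same norm. *)
Lemma absolute_le_coord (j : 'I_K) (s t : 'cV[R]_K) : `|s j 0| <= `|t j 0| ->
  (forall i, i != j -> s i 0 = t i 0) -> theta s <= theta t.
Proof.
move=> stj st.
have [tj0|tj0] := eqVneq (t j 0) 0.
  rewrite le_eqVlt (@absolute_eq s t) ?eqxx // => i.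
  have [->|/st ->//] := eqVneq i j.
  by move: stj; rewrite tj0 normr0 normr_le0 => /eqP ->; rewrite normr0.
pose t' := \col_i (if i == j then - t i 0 else t i 0).
have t't : theta t' = theta t.
  by apply: absolute_eq => i; rewrite mxE; case: ifP; rewrite ?normrN.
pose l := s j 0 / t j 0.
have : `|l| <= 1 by rewrite normrM normfV ler_pdivrMr ?normr_gt0 // mul1r.
rewrite ler_norml => /andP[l1 l2].
have sE : s = ((1 + l) / 2) *: t + ((1 - l) / 2) *: t'.
  apply/colP => i; rewrite !mxE; case: eqP => [->|/eqP/st ->]; last by field.
  by rewrite /l; field.
rewrite [in leLHS]sE; apply: le_trans (is_norm_triangle thetaN _ _) _.
rewrite !(is_normZ thetaN) t't !ger0_norm; lra.
Qed.

(** The coordinates of [t] are replaced by those of [s] one at a time. *)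
Lemma absolute_le (s t : 'cV[R]_K) :
  (forall i, `|s i 0| <= `|t i 0|) -> theta s <= theta t.
Proof.
move=> st; pose mix m : 'cV[R]_K := \col_i (if (i < m)%N then s i 0 else t i 0).
have mixP m : theta (mix m) <= theta t.
  elim: m => [|m IH].
    by rewrite le_eqVlt (@absolute_eq _ t) ?eqxx // => i; rewrite mxE ltn0.
  apply: le_trans IH; have [mK|Km] := ltnP m K; last first.
    rewrite le_eqVlt (@absolute_eq _ (mix m)) ?eqxx // => i.
    by rewrite !mxE !(leq_trans (ltn_ord i)) // ltnW.
  apply: (@absolute_le_coord (Ordinal mK)) => [|i im].
    by rewrite !mxE /= ltnS leqnn ltnn.
  rewrite !mxE ltnS leq_eqVlt; case: eqP => // imE.
  by move: im; rewrite -val_eqE /= imE eqxx.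
apply: le_trans (mixP K); rewrite le_eqVlt (@absolute_eq _ (mix K)) ?eqxx // => i.
by rewrite mxE ltn_ord.
Qed.

(** Coordinatewise [2 |a b| <= c a^2 + b^2 / c] for every [c > 0]; the best [c] is
    taken only after applying the norm. *)
Lemma absolute_cauchy_schwarz (a b z : 'cV[R]_K) :
  (forall i, `|z i 0| <= 2 * `|a i 0 * b i 0|) ->
  theta z <= 2 * (Num.sqrt (theta (\col_i a i 0 ^+ 2)) *
                  Num.sqrt (theta (\col_i b i 0 ^+ 2))).
Proof.
move=> zab; apply: le_2mul_of_forall_scaling; rewrite ?sqrtr_ge0 // => c c0.
rewrite !sqr_sqrtr ?(is_norm_ge0 thetaN) //.
have ci0 : 0 < c^-1 by rewrite invr_gt0.
apply: (@le_trans _ _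
    (theta (c *: (\col_i a i 0 ^+ 2) + c^-1 *: (\col_i b i 0 ^+ 2)))); last first.
  apply: le_trans (is_norm_triangle thetaN _ _) _.
  by rewrite !(is_normZ thetaN) !gtr0_norm.
apply: absolute_le => i; apply: le_trans (zab i) _; rewrite !mxE.
rewrite -(real_normK (num_real (a i 0))) -(real_normK (num_real (b i 0))).
rewrite normrM [leRHS]ger0_norm; last first.
  by rewrite addr_ge0 // mulr_ge0 ?sqr_ge0 ?ltW.
rewrite -subr_ge0.
have -> : c * `|a i 0| ^+ 2 + c^-1 * `|b i 0| ^+ 2 - 2 * (`|a i 0| * `|b i 0|) =
    c^-1 * (c * `|a i 0| - `|b i 0|) ^+ 2 by field; rewrite gt_eqF.
by rewrite mulr_ge0 ?sqr_ge0 ?ltW.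
Qed.

End Absolute.

(** * Block norms *)

Section Block.
Variables (R : realType) (K : nat) (n : 'I_K -> nat).
Variables (theta : 'cV[R]_K -> R) (p : forall i : 'I_K, 'cV[R]_(n i) -> R).
Hypothesis thetaN : is_norm theta.
Hypothesis theta_abs : absolute theta.
Hypothesis pN : forall i, is_norm (@p i).

Definition block_sq (x : 'cV[R]_(\sum_(i < K) n i)) : 'cV[R]_K :=
  \col_i p (submxcol x i) ^+ 2.

Lemma block_norm_sq x : block_norm theta p x ^+ 2 = theta (block_sq x).
Proof. by rewrite sqr_sqrtr // is_norm_ge0. Qed.

Lemma block_norm_is_norm : is_norm (block_norm theta p).
Proof.
split=> [x|x|a x|x y]; first exact: sqrtr_ge0.
- move=> x0; have : theta (block_sq x) = 0 by rewrite -block_norm_sq x0 expr0n.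
  move=> /(is_norm_eq0 thetaN)/colP sq0; apply/mxcolP => i; rewrite submxcol0.
  apply: (is_norm_eq0 (pN i)).
  by have /eqP := sq0 i; rewrite !mxE sqrf_eq0 => /eqP.
- have -> : block_norm theta p (a *: x) =
      Num.sqrt (a ^+ 2 * theta (block_sq x)); last first.
    by rewrite sqrtrM ?sqr_ge0 // sqrtr_sqr.
  congr Num.sqrt; rewrite -[a ^+ 2]ger0_norm ?sqr_ge0 // -(is_normZ thetaN).
  congr theta; apply/colP => i; rewrite !mxE.
  have -> : submxcol (a *: x) i = a *: submxcol x i.
    by apply/matrixP => j k; rewrite !mxE.
  by rewrite (is_normZ (pN i)) exprMn real_normK ?num_real.
- apply: le_add_of_sq_triangle; rewrite ?sqrtr_ge0 // => c c0.
  have ci0 : 0 < c^-1 by rewrite invr_gt0.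
  rewrite !block_norm_sq; apply: (@le_trans _ _
     (theta ((1 + c) *: block_sq x + (1 + c^-1) *: block_sq y))).
    apply: (absolute_le thetaN theta_abs) => i; rewrite !mxE.
    rewrite !ger0_norm ?sqr_ge0 ?addr_ge0 ?(mulr_ge0 _ (sqr_ge0 _)) ?addr_ge0
      ?(ltW c0) ?(ltW ci0) //.
    by rewrite submxcolD; exact: (sq_norm_triangle (pN i)).
  apply: le_trans (is_norm_triangle thetaN _ _) _.
  by rewrite !(is_normZ thetaN) !ger0_norm //; lra.
Qed.

(** In [2 * kappabar + kappa'], the part [kappa'] comes from the quadratic terms
    of the blocks and [2 * kappabar] from that of [theta], whose argument [u] has
    norm at most [2 block_norm(x) block_norm(h)]. *)
Lemma block_quad_upper kappabar kappa' : 1 <= kappabar -> 1 <= kappa' ->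
  quad_upper theta kappabar -> (forall i, quad_upper (@p i) kappa') ->
  quad_upper (block_norm theta p) (2 * kappabar + kappa').
Proof.
move=> kb1 k1 theta_quad p_quad x.
have Phi0 := is_norm_ge0 block_norm_is_norm.
pose y := block_sq x.
(* At the origin the square root is not differentiable, but Phi is its own
   quadratic remainder there and the slope is zero. *)
have [y0|y_neq0] := eqVneq (theta y) 0.
  have x0 : x = 0.
    apply: (is_norm_eq0 block_norm_is_norm).
    by apply/eqP; rewrite -sqrf_eq0 block_norm_sq y0.
  exists 0 => h; rewrite x0 add0r mul0mx mxE (is_norm0 block_norm_is_norm).
  by rewrite expr0n !add0r ler_peMl ?sqr_ge0 //; lra.
have ygt0 : 0 < theta y by rewrite lt_def y_neq0 is_norm_ge0.
have /all_sig[g gP] : forall i, {g : 'rV[R]_(n i) | forall h,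
    p (submxcol x i + h) ^+ 2 <=
    p (submxcol x i) ^+ 2 + (g *m h) 0 0 + kappa' * p h ^+ 2}.
  by move=> i; apply: cid; exact: p_quad.
have [G GP] := theta_quad y.
(* The factor is the derivative of the square root at theta(y)^2. *)
exists ((2 * theta y)^-1 *: \mxrow_i (G 0 i *: g i)) => h.
pose u : 'cV[R]_K := \col_i (g i *m submxcol h i) 0 0.
have slopeE : ((2 * theta y)^-1 *: \mxrow_i (G 0 i *: g i) *m h) 0 0 =
    (2 * theta y)^-1 * (G *m u) 0 0.
  rewrite -scalemxAl mxE; congr (_ * _).
  rewrite -{1}[h]submxcolK mul_mxrow_mxcol summxE mxE.
  by apply: eq_bigr => i _; rewrite -scalemxAl !mxE.
have u_le : theta u <= 2 * (block_norm theta p x * block_norm theta p h).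
  apply: le_trans (@absolute_cauchy_schwarz _ _ _ thetaN theta_abs
    (\col_i p (submxcol x i)) (\col_i p (submxcol h i)) u _) _.
    move=> i; have := quad_slope_le (pN i) k1 (gP i) (submxcol h i).
    by rewrite !mxE [`|p _ * p _|]ger0_norm // mulr_ge0 ?(is_norm_ge0 (pN i)).
  rewrite le_eqVlt; apply/orP; left; apply/eqP; do 2 congr (_ * _);
    by congr (Num.sqrt (theta _)); apply/colP => i; rewrite !mxE.
have drop_block_remainders :
    theta (block_sq (x + h)) <= theta (y + u) + kappa' * theta (block_sq h).
  apply: (@le_trans _ _ (theta (y + u + kappa' *: block_sq h))); last first.
    apply: le_trans (is_norm_triangle thetaN _ _) _.
    by rewrite (is_normZ thetaN) ger0_norm //; lra.
  apply: (absolute_le thetaN theta_abs) => i; rewrite !mxE submxcolD.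
  rewrite ger0_norm ?sqr_ge0 //; apply: le_trans (ler_norm _).
  by have := gP i (submxcol h i); rewrite !mxE.
have expand_theta : theta (y + u) <=
    theta y + (2 * theta y)^-1 * (G *m u) 0 0 + 2 * kappabar * theta (block_sq h).
  have u_sq : theta u ^+ 2 <= 4 * (theta y * theta (block_sq h)).
    rewrite -!block_norm_sq.
    have -> : 4 * (block_norm theta p x ^+ 2 * block_norm theta p h ^+ 2) =
      (2 * (block_norm theta p x * block_norm theta p h)) ^+ 2 by ring.
    by rewrite ler_sqr ?nnegrE ?mulr_ge0 // is_norm_ge0.
  have ku_sq : kappabar * theta u ^+ 2 <=
      kappabar * (4 * (theta y * theta (block_sq h))).
    by rewrite ler_wpM2l //; lra.
  have amgm : 2 * theta y * theta (y + u) <= theta y ^+ 2 + theta (y + u) ^+ 2.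
    by have := sqr_ge0 (theta y - theta (y + u)); rewrite sqrrB; lra.
  have y2 : 0 < 2 * theta y by lra.
  rewrite -(ler_pM2l y2) !mulrDr mulVKf ?gt_eqF //.
  have := GP u; lra.
by rewrite !block_norm_sq slopeE; lra.
Qed.

End Block.

(** Block norms depend quadratically on the inner norms and through a square root
    on the outer one, so constants enter as [s] and [Num.sqrt t]. *)
Lemma block_norm_le (R : realType) (K : nat) (n : 'I_K -> nat)
    (theta theta' : 'cV[R]_K -> R) (p p' : forall i : 'I_K, 'cV[R]_(n i) -> R)
    (s t : R) :
  0 <= s -> 0 <= t -> is_norm theta -> absolute theta ->
  (forall i, is_norm (@p i)) ->
  (forall i z, p i z <= s * p' i z) -> (forall z, theta z <= t * theta' z) ->
  forall x, block_norm theta p x <= s * Num.sqrt t * block_norm theta' p' x.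
Proof.
move=> s0 t0 thetaN theta_abs pN pp' tt' x.
rewrite -mulrA -sqrtrM // -[X in X * _](ger0_norm s0) -sqrtr_sqr -sqrtrM ?sqr_ge0 //.
apply/ler_wsqrtr/(@le_trans _ _ (s ^+ 2 * theta (block_sq p' x))); last first.
  by rewrite ler_wpM2l ?sqr_ge0.
rewrite -[s ^+ 2]ger0_norm ?sqr_ge0 // -(is_normZ thetaN).
apply: (absolute_le thetaN theta_abs) => i; rewrite !mxE.
rewrite !ger0_norm ?(mulr_ge0 _ (sqr_ge0 _)) ?sqr_ge0 // -exprMn.
have p0 := is_norm_ge0 (pN i) (submxcol x i).
by rewrite ler_sqr ?nnegrE // (le_trans p0).
Qed.

(** * Averaging over sign changes *)

Definition sign_mx (R : realType) (K : nat) (e : {ffun 'I_K -> bool}) : 'M[R]_K :=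
  diag_mx (\row_i (-1) ^+ e i).

Definition sign_mean (R : realType) (K : nat) (p : 'cV[R]_K -> R)
    (x : 'cV[R]_K) : R :=
  Num.sqrt (#|{ffun 'I_K -> bool}|%:R^-1 *
            \sum_(e : {ffun 'I_K -> bool}) p (sign_mx R e *m x) ^+ 2).

Section SignMean.
Variables (R : realType) (K : nat) (p : 'cV[R]_K -> R).

Lemma sign_mxE (e : {ffun 'I_K -> bool}) (x : 'cV[R]_K) i :
  (sign_mx R e *m x) i 0 = (-1) ^+ e i * x i 0.
Proof. by rewrite mul_diag_mx !mxE. Qed.

Let N : R := #|{ffun 'I_K -> bool}|%:R.

Lemma sign_count_gt0 : 0 < N.
Proof. by rewrite ltr0n; apply/card_gt0P; exists [ffun=> false]. Qed.

Lemma sign_mean_sq x : sign_mean p x ^+ 2 =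
  N^-1 * \sum_(e : {ffun 'I_K -> bool}) p (sign_mx R e *m x) ^+ 2.
Proof.
rewrite sqr_sqrtr // mulr_ge0 ?invr_ge0 ?(ltW sign_count_gt0) //.
by rewrite sumr_ge0 // => e _; exact: sqr_ge0.
Qed.

Lemma sign_mean_le_mean x (f : {ffun 'I_K -> bool} -> R) :
  (forall e, p (sign_mx R e *m x) ^+ 2 <= f e) ->
  sign_mean p x ^+ 2 <= N^-1 * \sum_e f e.
Proof.
move=> pf; rewrite sign_mean_sq ler_wpM2l ?invr_ge0 ?(ltW sign_count_gt0) //.
by apply: ler_sum => e _.
Qed.

Hypothesis pN : is_norm p.

Lemma sign_mean_is_norm : is_norm (sign_mean p).
Proof.
split=> [x|x|a x|x y]; first exact: sqrtr_ge0.
- move=> x0; have := sign_mean_sq x; rewrite x0 expr0n => /esym/eqP.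
  rewrite mulf_eq0 invr_eq0 (gt_eqF sign_count_gt0) /=.
  rewrite psumr_eq0 => [/allP/(_ [ffun=> false])|e _]; last exact: sqr_ge0.
  rewrite mem_index_enum sqrf_eq0 => /(_ isT)/eqP/(is_norm_eq0 pN)/colP e0.
  by apply/colP => i; have := e0 i; rewrite sign_mxE ffunE mul1r.
- rewrite /sign_mean -[`|a|]sqrtr_sqr -sqrtrM ?sqr_ge0 //.
  congr Num.sqrt; rewrite mulrCA; congr (_ * _); rewrite mulr_sumr.
  apply: eq_bigr => e _.
  by rewrite -scalemxAr (is_normZ pN) exprMn real_normK ?num_real.
- apply: le_add_of_sq_triangle; rewrite ?sqrtr_ge0 // => c c0.
  apply: le_trans (@sign_mean_le_mean _ (fun e =>
    (1 + c) * p (sign_mx R e *m x) ^+ 2 + (1 + c^-1) * p (sign_mx R e *m y) ^+ 2)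
    _) _ => [e|].
    by rewrite mulmxDr; exact: (sq_norm_triangle pN).
  by rewrite big_split /= -!mulr_sumr mulrDr !sign_mean_sq !(mulrCA N^-1).
Qed.

(** Replacing [x] by [|x|] multiplies every sign pattern by the signs of [x],
    which only permutes the terms of the mean. *)
Lemma sign_mean_absolute : absolute (sign_mean p).
Proof.
move=> x; congr (Num.sqrt (_ * _)).
pose s i := x i 0 < 0.
pose flip (e : {ffun 'I_K -> bool}) := [ffun i => e i (+) s i].
have flipK : involutive flip.
  by move=> e; apply/ffunP => i; rewrite !ffunE -addbA addbb addbF.
rewrite (reindex_inj (inv_inj flipK)); apply: eq_bigr => e _.
congr (p _ ^+ 2); apply/colP => i; rewrite !sign_mxE !mxE ffunE signr_addb -mulrA.
congr (_ * _); rewrite /s; case: ltrP => x0; first by rewrite mulN1r ltr0_norm.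
by rewrite mul1r ger0_norm.
Qed.

Lemma sign_mean_quad_upper kappa :
  quad_upper p kappa -> quad_upper (sign_mean p) kappa.
Proof.
move=> p_quad x.
have /choice[g gP] : forall e, exists g : 'rV[R]_K, forall h,
    p (sign_mx R e *m x + h) ^+ 2 <=
    p (sign_mx R e *m x) ^+ 2 + (g *m h) 0 0 + kappa * p h ^+ 2.
  by move=> e; exact: p_quad.
exists (N^-1 *: \sum_e (g e *m sign_mx R e)) => h.
apply: le_trans (@sign_mean_le_mean _ (fun e =>
  p (sign_mx R e *m x) ^+ 2 + (g e *m (sign_mx R e *m h)) 0 0 +
  kappa * p (sign_mx R e *m h) ^+ 2) _) _ => [e|].
  by rewrite mulmxDr; exact: gP.
have -> : (N^-1 *: (\sum_e g e *m sign_mx R e) *m h) 0 0 =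
    N^-1 * \sum_e (g e *m (sign_mx R e *m h)) 0 0.
  rewrite -scalemxAl mxE mulmx_suml summxE; congr (_ * _).
  by apply: eq_bigr => e _; rewrite mulmxA.
by rewrite !big_split /= -mulr_sumr !mulrDr !sign_mean_sq (mulrCA N^-1 kappa).
Qed.

(** As [theta] is invariant under sign changes, its square is the mean of the
    values that are compared with the terms of [sign_mean p]. *)
Lemma sign_mean_equiv (theta : 'cV[R]_K -> R) sigma : 1 <= sigma ->
  is_norm theta -> absolute theta ->
  (forall x, sigma^-1 * p x <= theta x <= sigma * p x) ->
  forall x, sigma^-1 * sign_mean p x <= theta x <= sigma * sign_mean p x.
Proof.
move=> s1 thetaN theta_abs equiv x.
have s0 : 0 < sigma by lra.
have theta0 := is_norm_ge0 thetaN x.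
have sm0 : 0 <= sign_mean p x by exact: sqrtr_ge0.
have theta_sign e : theta (sign_mx R e *m x) = theta x.
  by apply: absolute_eq => // i; rewrite sign_mxE normrM normr_sign mul1r.
have theta_mean : theta x ^+ 2 = N^-1 * \sum_(e : {ffun 'I_K -> bool}) theta x ^+ 2.
  by rewrite sumr_const -[_ *+ _]mulr_natl mulKf // gt_eqF // sign_count_gt0.
have Ni0 : 0 <= N^-1 by rewrite invr_ge0 (ltW sign_count_gt0).
apply/andP; split.
  rewrite ler_pdivrMl // -ler_sqr ?nnegrE ?mulr_ge0 ?(ltW s0) //.
  rewrite exprMn theta_mean mulrCA mulr_sumr.
  apply: sign_mean_le_mean => e; rewrite -exprMn.
  rewrite ler_sqr ?nnegrE ?mulr_ge0 ?(ltW s0) ?(is_norm_ge0 pN) //.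
  by have /andP[+ _] := equiv (sign_mx R e *m x); rewrite theta_sign ler_pdivrMl.
rewrite -ler_sqr ?nnegrE ?mulr_ge0 ?(ltW s0) //.
rewrite exprMn theta_mean sign_mean_sq mulrCA [X in _ <= _ * X]mulr_sumr ler_wpM2l //.
apply: ler_sum => e _; rewrite -exprMn.
rewrite ler_sqr ?nnegrE ?mulr_ge0 ?(ltW s0) ?(is_norm_ge0 pN) //.
by have /andP[_] := equiv (sign_mx R e *m x); rewrite theta_sign.
Qed.

End SignMean.

(** * Regularity of block norms *)

Theorem theorem2p2 (R : realType) (K : nat) (n : 'I_K -> nat)
    (theta : 'cV[R]_K -> R) (nrm : forall i : 'I_K, 'cV[R]_(n i) -> R)
    (kappabar sigmabar kappa' sigma' : R)
    (kappabar_ge1 : 1 <= kappabar) (sigmabar_ge1 : 1 <= sigmabar)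
    (kappa'_ge1 : 1 <= kappa') (sigma'_ge1 : 1 <= sigma')
    (theta_abs : absolute theta)
    (theta_reg : regular_norm kappabar sigmabar theta)
    (nrm_reg : forall i : 'I_K, regular_norm kappa' sigma' (nrm i)) :
  regular_norm (2 * kappabar + kappa') (sigma' * Num.sqrt sigmabar)
    (block_norm theta nrm).
Proof.
have [_ _ thetaN [q [q_smooth q_equiv]]] := theta_reg.
have qN : is_norm q by case: q_smooth.
pose vartheta := sign_mean q.
have varthetaN : is_norm vartheta := sign_mean_is_norm qN.
have vartheta_abs : absolute vartheta := sign_mean_absolute q.
have vartheta_quad : quad_upper vartheta kappabar.
  exact/sign_mean_quad_upper/quad_upper_of_smooth_norm.
have vartheta_equiv := sign_mean_equiv qN sigmabar_ge1 thetaN theta_abs q_equiv.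
have /all_sig[p pP] : forall i, {p : 'cV[R]_(n i) -> R | smooth_norm kappa' p /\
    forall x, sigma'^-1 * p x <= nrm i x <= sigma' * p x}.
  by move=> i; apply: cid; have [] := nrm_reg i.
have pN i : is_norm (@p i) by have [[]] := pP i.
have nrmN i : is_norm (nrm i) by have [] := nrm_reg i.
have kappa_ge1 : 1 <= 2 * kappabar + kappa' by lra.
have sqrt_ge1 : 1 <= Num.sqrt sigmabar by rewrite -sqrtr1 ler_wsqrtr.
have s'0 : 0 < sigma' by lra.
have sb0 : 0 < sigmabar by lra.
split => //.
- by rewrite -[1]mulr1 ler_pM.
- exact: block_norm_is_norm.
exists (block_norm vartheta p); split.
  apply: smooth_norm_of_quad_upper => //; first exact: block_norm_is_norm.
  apply: block_quad_upper => // i.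
  by apply: quad_upper_of_smooth_norm; have [] := pP i.
move=> x.
have p_nrm i z : p i z <= sigma' * nrm i z.
  by have [_ /(_ z)/andP[+ _]] := pP i; rewrite ler_pdivrMl.
have vartheta_theta t : vartheta t <= sigmabar * theta t.
  by have /andP[+ _] := vartheta_equiv t; rewrite ler_pdivrMl.
apply/andP; split.
  rewrite ler_pdivrMl; last by rewrite mulr_gt0 //; lra.
  by apply: block_norm_le => //; exact: ltW.
apply: block_norm_le => //; try exact: ltW.
- by move=> i z; have [_ /(_ z)/andP[]] := pP i.
- by move=> t; have /andP[] := vartheta_equiv t.
Qed.
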